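(* For any $\lambda<1/3$, there exists a sequence $\Sigma=(a_1,\dots,a_n)$ of $\left(\lambda^3 n^2 2^{f(\lambda) n}\right)$-bounded positive integers that is $\mathcal{F}_{\lambda,n}$-sum distinct.
   Context: Here $n\ge 1$ is an integer. Logarithms are in base $2$, and $f(\lambda)=H(\lambda,\lambda,1-2\lambda)$, where $H(p_1,\dots,p_h)=\sum_{i=1}^h -p_i\log p_i$ is the Shannon entropy of a probability vector $(p_1,\dots,p_h)$. $\mathcal{F}_{\lambda,n}$ denotes the family of all subsets of $\{1,\dots,n\}$ whose size is smaller than or equal to $\lambda n$. A sequence $(a_1,\dots,a_n)$ of integers is $M$-bounded if $a_i\in[0,M]$ for all $i$. For $A\subseteq\{1,\dots,n\}$ put $S(A)=\sum_{i\in A}a_i$. The sequence is $\mathcal{F}_{\lambda,n}$-sum distinct if $S(A_1)\neq S(A_2)$ for all distinct $A_1,A_2\in\mathcal{F}_{\lambda,n}$.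
   Formalization: The hypothesis λ³n²2^{f(λ)n} ≥ 1 is added (it forces λ > 0); without it no positive integer satisfies the bound, e.g. n = 1, λ = 1/10, so exactly the cases where the claim fails are excluded. *)

(* Defs.v *)
From mathcomp Require Import all_boot all_order all_algebra.
From mathcomp Require Import reals exp.

Set Implicit Arguments.
Unset Strict Implicit.
Unset Printing Implicit Defensive.

Import Order.TTheory GRing.Theory Num.Theory.
Local Open Scope ring_scope.

Definition log2 (R : realType) (x : R) : R := ln x / ln 2.

(* The convention 0 log 0 = 0 holds automatically, because of the factor p_i. *)
Definition entropy (R : realType) (h : nat) (p : h.-tuple R) : R :=
  \sum_(i < h) - tnth p i * log2 (tnth p i).

Definition f_ent (R : realType) (lam : R) : R :=
  entropy [tuple lam; lam; 1 - 2 * lam].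

(* The ground set {1, ..., n} is represented by 'I_n. *)
Definition small_subsets (R : realType) (lam : R) (n : nat) : {set {set 'I_n}} :=
  [set A : {set 'I_n} | (#|A|%:R : R) <= lam * n%:R].

Definition bounded_by (R : realType) (M : R) (n : nat) (a : 'I_n -> int) : Prop :=
  forall i : 'I_n, 0 <= ((a i)%:~R : R) <= M.

Definition subset_sum (n : nat) (a : 'I_n -> int) (A : {set 'I_n}) : int :=
  \sum_(i in A) a i.

Definition sum_distinct (n : nat) (F : {set {set 'I_n}}) (a : 'I_n -> int) : Prop :=
  forall A1 A2 : {set 'I_n}, A1 \in F -> A2 \in F -> A1 <> A2 ->
    subset_sum a A1 <> subset_sum a A2.

Definition sum_bound (R : realType) (lam : R) (n : nat) : R :=
  lam ^+ 3 * n%:R ^+ 2 * 2 `^ (f_ent lam * n%:R).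

(* Main.v *)
Require Import Defs.
From mathcomp Require Import all_boot all_order all_algebra.
From mathcomp Require Import reals sequences exp.
From mathcomp Require Import ring lra.
Import Order.TTheory GRing.Theory Num.Theory.
Local Open Scope ring_scope.

(** The sequence is built greedily, one index at a time. A coincidence
    S(A1) = S(A2) may be reduced to disjoint sets by removing the common
    elements. When the value at an index x is chosen, a coincidence S(A) = S(B)
    between disjoint small sets with x in A forbids exactly the single value
    S(B) - S(A \ x). So it is enough that there are at most M = sum_bound lam n
    such pairs (A, B): one of the forbidden values is 0, coming from
    A = {x} and B empty, so that a positive integer not exceeding M is left.

    The pairs are counted with an entropy argument ([card_rooted_le]). Label
    each index independently by A, B or neither with probabilities lam, lam,
    1 - 2 lam. The index x is labelled A with probability lam, while each
    labelling with |A|, |B| <= lam n has probability at least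
    2 ^ (- f(lam) n) because lam <= 1 - 2 lam ([prod_label_weight_ge]). Hence
    there are at most lam 2 ^ (f(lam) n) such pairs, and this is at most M as
    soon as lam n >= 1, since M is (lam n)^2 times as large. If lam n < 1, the
    empty set is the only small set and the constant sequence 1 works. *)

(** * Labellings by disjoint pairs of sets *)

(** A labelling encodes an ordered pair of disjoint sets, its parts at [true]
    and [false]; in this form the probabilities of all pairs factor over the
    indices. *)
Notation labelling n := {ffun 'I_n -> option bool}.

Definition part {n : nat} (g : labelling n) (b : bool) : {set 'I_n} :=
  [set i | g i == Some b].

Definition label_weight {R : realType} (lam : R) (s : option bool) : R :=
  if s is Some _ then lam else 1 - 2 * lam.

(** These are the pairs of small sets whose coincidence constrains the value
    at [x]; by symmetry it may be assumed that [x] lies in the first set. *)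
Definition rooted_labellings {R : realType} (lam : R) {n : nat} (x : 'I_n) :
    {set labelling n} :=
  [set g : labelling n | (g x == Some true) &&
           [forall b : bool, part g b \in small_subsets lam n]].

Lemma part_of_disjoint (n : nat) (A B : {set 'I_n}) :
  [disjoint A & B] -> exists g : labelling n, part g true = A /\ part g false = B.
Proof.
move=> dAB.
exists [ffun i => if i \in A then Some true
                  else if i \in B then Some false else None].
split; apply/setP=> i; rewrite !inE ffunE; have := disjointFr (x := i) dAB;
  by case: (i \in A) => [/(_ isT)|_]; case: (i \in B).
Qed.

Lemma prod_label_weight (R : realType) (lam : R) (n : nat) (g : labelling n) :
  let j := #|[set i | g i != None]| in
  \prod_i label_weight lam (g i) = lam ^+ j * (1 - 2 * lam) ^+ (n - j).
Proof.
move=> j; rewrite (bigID (mem [set i | g i != None])) /=; congr (_ * _).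
  rewrite -prodr_const; apply: eq_bigr => i; rewrite inE.
  by case: (g i).
have -> : (n - j)%N = #|~: [set i | g i != None]|.
  by rewrite -[n in (n - j)%N]card_ord -(cardsC [set i | g i != None]) addKn.
rewrite -prodr_const; apply: eq_big => [i|i]; rewrite !inE //.
by case: (g i).
Qed.

Lemma sum_label_weight (R : realType) (lam : R) :
  \sum_s label_weight lam s = 1.
Proof.
rewrite (bigD1 None) //= (bigD1 (Some true)) //= (bigD1 (Some false)) //=.
rewrite big1; last by case=> [[]|].
lra.
Qed.

(** This is the probability that [x] gets the label [Some true]. *)
Lemma sum_rooted_weight (R : realType) (lam : R) (n : nat) (x : 'I_n) :
  \sum_(g : labelling n | g x == Some true) \prod_i label_weight lam (g i) = lam.
Proof.
(* The constraint at x is absorbed into the weights, which then still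
   factor over the indices. *)
pose F i s := if (i == x) && (s != Some true) then 0 else label_weight lam s.
transitivity (\sum_(g : labelling n) \prod_i F i (g i)).
  rewrite [RHS](bigID (fun g : labelling n => g x == Some true)) /=.
  rewrite [X in _ + X]big1 ?addr0 => [|g gx].
    apply: eq_bigr => g /eqP gx; apply: eq_bigr => i _; rewrite /F.
    by case: eqP => [->|]; rewrite ?gx.
  by rewrite (bigD1 x) //= /F eqxx gx mul0r.
rewrite -(bigA_distr_bigA F) (bigD1 x) //= [X in _ * X]big1 ?mulr1 => [|i ix].
  rewrite (bigD1 (Some true)) //= big1 ?addr0 /F ?eqxx // => s sT.
  by rewrite sT.
rewrite -[RHS](sum_label_weight R lam); apply: eq_bigr => s _.
by rewrite /F (negbTE ix).
Qed.

(** * The entropy bound *)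

(** Replacing the number [j] of labelled indices by [2 lam n] can only lower
    the probability, since [lam <= 1 - 2 lam]; at [j = 2 lam n] it is exactly
    [2 ^ (- f(lam) n)]. *)
Lemma prod_label_weight_ge (R : realType) (lam : R) (n j : nat) :
  0 < lam -> lam < 1 / 3 -> (j <= n)%N -> j%:R <= 2 * (lam * n%:R) ->
  1 <= lam ^+ j * (1 - 2 * lam) ^+ (n - j) * 2 `^ (f_ent lam * n%:R).
Proof.
move=> lam0 lam3 jn jle.
have mu0 : 0 < 1 - 2 * lam by lra.
have ln2 : ln 2 != 0 :> R by rewrite gt_eqF// ln_gt0// ltr1n.
have lnle : ln lam <= ln (1 - 2 * lam) by rewrite ler_ln ?posrE//; lra.
have fE : f_ent lam * ln 2 =
    - (2 * lam * ln lam) - (1 - 2 * lam) * ln (1 - 2 * lam).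
  rewrite /f_ent /entropy /log2 !big_ord_recl big_ord0 !(tnth_nth 0) /=.
  by field.
have powE (y : R) m : 0 < y -> y ^+ m = expR (m%:R * ln y).
  by move=> y0; rewrite expRM_natl lnK.
rewrite /powR pnatr_eq0 /= !powE //.
rewrite -!expRD -[leLHS](@expR0 R) ler_expR (natrB _ jn).
rewrite [_ * ln 2]mulrAC fE.
have -> : j%:R * ln lam + (n%:R - j%:R) * ln (1 - 2 * lam) +
    (- (2 * lam * ln lam) - (1 - 2 * lam) * ln (1 - 2 * lam)) * n%:R =
    (2 * (lam * n%:R) - j%:R) * (ln (1 - 2 * lam) - ln lam) by ring.
by rewrite mulr_ge0 // subr_ge0.
Qed.

Lemma card_rooted_le (R : realType) (lam : R) (n : nat) (x : 'I_n) :
  0 < lam -> lam < 1 / 3 ->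
  #|rooted_labellings lam x|%:R <= lam * 2 `^ (f_ent lam * n%:R).
Proof.
move=> lam0 lam3.
rewrite -[X in X * _](sum_rooted_weight _ _ _ x) mulr_suml.
have W0 (g : labelling n) : 0 <= \prod_i label_weight lam (g i).
  by apply: prodr_ge0 => i _; rewrite /label_weight; case: (g i) => [_|]; lra.
rewrite -sum1_card natr_sum big_mkcond [leRHS]big_mkcond.
apply: ler_sum => g _; rewrite inE.
case: eqP => //= _; case: ifP => [/forallP small|_]; last first.
  by rewrite mulr_ge0 ?powR_ge0.
rewrite prod_label_weight; apply: prod_label_weight_ge => //.
  by rewrite -[leqRHS](card_ord n) max_card.
have : (#|[set i | g i != None]| <= #|part g true| + #|part g false|)%N.
  rewrite (leq_trans _ (leq_card_setU _ _)) // subset_leq_card //.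
  by apply/subsetP=> i; rewrite !inE; case: (g i) => [[]|].
rewrite -(ler_nat R) natrD => /le_trans; apply.
by have := small true; have := small false; rewrite !inE; lra.
Qed.

(** * The greedy construction *)

(** The numbers [0], ..., [size s] are too many to all lie in [s]; as [0] does,
    a positive one does not. *)
Lemma exists_pos_notin (s : seq int) :
  0 \in s -> exists k : nat, [/\ (0 < k)%N, (k <= size s)%N & k%:Z \notin s].
Proof.
move=> s0; have [/allP all_s|/allPn[k]] :=
    boolP (all (fun k : nat => k%:Z \in s) (iota 0 (size s).+1)).
  have us : uniq (map Posz (iota 0 (size s).+1)).
    by rewrite map_inj_uniq ?iota_uniq // => i j [].
  have /(uniq_leq_size us) : {subset map Posz (iota 0 (size s).+1) <= s}.
    by move=> _ /mapP[k /all_s ks ->].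
  by rewrite size_map size_iota ltnn.
rewrite mem_iota add0n => ks kNs; exists k; split=> //.
by rewrite lt0n; apply: contraNneq kNs => ->.
Qed.

Definition disjoint_sum_distinct {n : nat} (F : {set {set 'I_n}})
    (D : {set 'I_n}) (a : 'I_n -> int) : Prop :=
  forall A B : {set 'I_n}, A \in F -> B \in F -> A \subset D -> B \subset D ->
    [disjoint A & B] -> subset_sum a A = subset_sum a B -> A = B.

Lemma small_subsetsS (R : realType) (lam : R) (n : nat) (A B : {set 'I_n}) :
  A \subset B -> B \in small_subsets lam n -> A \in small_subsets lam n.
Proof.
move=> /subset_leq_card; rewrite !inE -(ler_nat R).
exact: le_trans.
Qed.

(** Common elements contribute equally to both sums, and removing them keeps
    the sets small. *)
Lemma disjoint_sum_distinctT (R : realType) (lam : R) (n : nat) a :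
  disjoint_sum_distinct (small_subsets lam n) setT a ->
  sum_distinct (small_subsets lam n) a.
Proof.
move=> da A B AF BF neqAB; rewrite /subset_sum => eqS; apply: neqAB.
have D0 : A :\: B = B :\: A.
  apply: da; rewrite ?subsetT //.
  - exact: small_subsetsS (subsetDl _ _) AF.
  - exact: small_subsetsS (subsetDl _ _) BF.
  - rewrite -setI_eq0; apply/eqP/setP=> i; rewrite !inE.
    by case: (i \in A); case: (i \in B).
  move: eqS; rewrite (big_setID B) /= [RHS](big_setID A) /= setIC.
  exact: addrI.
apply/setP=> i; move/setP/(_ i): D0; rewrite !inE.
by case: (i \in A); case: (i \in B).
Qed.

Definition update {n : nat} (a : 'I_n -> int) (x : 'I_n) (v : int) :=
  fun i => if i == x then v else a i.

Lemma subset_sum_update n (a : 'I_n -> int) x v (A : {set 'I_n}) :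
  x \notin A -> subset_sum (update a x v) A = subset_sum a A.
Proof.
move=> xA; apply: eq_bigr => i iA; rewrite /update.
by case: eqP xA => // <-; rewrite iA.
Qed.

Lemma subset_sum_update_in n (a : 'I_n -> int) x v (A : {set 'I_n}) :
  x \in A -> subset_sum (update a x v) A = v + subset_sum a (A :\ x).
Proof.
move=> xA; rewrite /subset_sum (big_setD1 x) //= {1}/update eqxx.
by congr (_ + _); apply: subset_sum_update; rewrite !inE eqxx.
Qed.

Definition forbidden_values {R : realType} (lam : R) {n : nat}
    (a : 'I_n -> int) (x : 'I_n) : seq int :=
  [seq subset_sum a (part g false) - subset_sum a (part g true :\ x)
     | g in rooted_labellings lam x].

Lemma mem_forbidden_values (R : realType) (lam : R) (n : nat) (a : 'I_n -> int)
    (x : 'I_n) (A B : {set 'I_n}) :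
  A \in small_subsets lam n -> B \in small_subsets lam n ->
  [disjoint A & B] -> x \in A ->
  subset_sum a B - subset_sum a (A :\ x) \in forbidden_values lam a x.
Proof.
move=> AF BF dAB; have [g [gA gB]] := part_of_disjoint _ _ _ dAB.
rewrite -{}gA -{}gB in AF BF dAB *; rewrite inE => gx.
apply/imageP; exists g => //; rewrite inE gx.
by apply/forallP=> -[].
Qed.

(** Changing the value at [x] preserves every distinctness already obtained
    away from [x]; for a pair with [x] in one of the sets, a coincidence could
    only occur if [v] were the value which that pair forbids. *)
Lemma greedy_step (R : realType) (lam : R) (n : nat) (D : {set 'I_n})
    (x : 'I_n) (a : 'I_n -> int) (v : int) :
  v \notin forbidden_values lam a x ->
  disjoint_sum_distinct (small_subsets lam n) (D :\ x) a ->
  disjoint_sum_distinct (small_subsets lam n) D (update a x v).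
Proof.
move=> vN da.
have notin A B : A \in small_subsets lam n -> B \in small_subsets lam n ->
    [disjoint A & B] -> subset_sum (update a x v) A = subset_sum (update a x v) B ->
    x \notin A.
  move=> AF BF dAB; apply: contra_eqN => xA.
  rewrite subset_sum_update_in // subset_sum_update ?(disjointFr dAB) //.
  apply: contra vN => /eqP eqS.
  have -> : v = subset_sum a B - subset_sum a (A :\ x) by rewrite -eqS addrK.
  exact: mem_forbidden_values.
move=> A B AF BF AD BD dAB eqS.
have xA := notin _ _ AF BF dAB eqS.
have xB : x \notin B by apply: (notin _ A); rewrite // disjoint_sym.
rewrite !subset_sum_update // in eqS.
by apply: da; rewrite // subsetD1 ?AD ?BD.
Qed.

Lemma card_forbidden_le (R : realType) (lam : R) (n : nat) (a : 'I_n -> int) x :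
  0 < lam -> lam < 1 / 3 -> 1 <= lam * n%:R ->
  (size (forbidden_values lam a x))%:R <= sum_bound lam n.
Proof.
move=> lam0 lam3 lamn; rewrite size_image.
apply: le_trans (card_rooted_le _ _ _ _ lam0 lam3) _.
rewrite /sum_bound ler_wpM2r ?powR_ge0 //.
have -> : lam ^+ 3 * n%:R ^+ 2 = lam * (lam * n%:R) ^+ 2 by ring.
by rewrite ler_peMr ?(ltW lam0) // exprn_ege1.
Qed.

Lemma exists_free_value (R : realType) (lam : R) (n : nat) (a : 'I_n -> int) x :
  0 < lam -> lam < 1 / 3 -> 1 <= lam * n%:R ->
  exists v : int, [/\ 0 < v, v%:~R <= sum_bound lam n
                   & v \notin forbidden_values lam a x].
Proof.
move=> lam0 lam3 lamn.
have [|k [k0 ks kN]] := exists_pos_notin (forbidden_values lam a x).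
  (* The pair ({x}, set0) forbids the value 0. *)
  have := mem_forbidden_values R lam n a x [set x] set0.
  rewrite setDv /subset_sum !big_set0 subr0; apply; rewrite ?set11 //.
  - by rewrite inE cards1.
  - by rewrite inE cards0 (le_trans ler01).
  - by rewrite -setI_eq0 setI0.
exists k%:Z; split=> //.
by rewrite (le_trans _ (card_forbidden_le _ _ _ a x lam0 lam3 lamn)) // ler_nat.
Qed.

Lemma greedy_sequence (R : realType) (lam : R) (n : nat) (D : {set 'I_n}) :
  0 < lam -> lam < 1 / 3 -> 1 <= lam * n%:R -> 1 <= sum_bound lam n ->
  exists a : 'I_n -> int,
    [/\ forall i, 0 < a i, forall i, (a i)%:~R <= sum_bound lam n
      & disjoint_sum_distinct (small_subsets lam n) D a].
Proof.
move=> lam0 lam3 lamn M1.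
have [m] := ubnP #|D|; elim: m => // m IHm in D *; rewrite ltnS => Dm.
have [->|[x xD]] := set_0Vmem D.
  exists (fun=> 1); split=> // A B _ _.
  by rewrite !subset0 => /eqP-> /eqP->.
have [|a [a0 aM da]] := IHm (D :\ x).
  by rewrite (leq_trans _ Dm) // [leqRHS](cardsD1 x) xD.
have [v [v0 vM vN]] := exists_free_value R lam n a x lam0 lam3 lamn.
by exists (update a x v); split; [move=> i; rewrite /update; case: ifP..|
  exact: greedy_step da].
Qed.

Lemma sum_bound_ge1_gt0 (R : realType) (lam : R) (n : nat) :
  1 <= sum_bound lam n -> 0 < lam.
Proof.
move=> M1; rewrite ltNge; apply/negP=> lam0; move: M1.
apply/negP; rewrite -ltNge (le_lt_trans _ ltr01) // /sum_bound.
rewrite mulr_le0_ge0 ?powR_ge0 // mulr_le0_ge0 ?sqr_ge0 //.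
by rewrite exprS mulr_le0_ge0 ?sqr_ge0.
Qed.

(* The hypothesis [1 <= sum_bound lam n] says that positive integers bounded by
   [sum_bound lam n] exist at all; the conclusion implies it since n >= 1, and it
   forces 0 < lam. *)
Theorem theorem3p3 (R : realType) (lam : R) (n : nat) :
  (1 <= n)%N -> lam < 1 / 3 -> 1 <= sum_bound lam n ->
  exists a : 'I_n -> int,
    [/\ forall i : 'I_n, 0 < a i,
        bounded_by (sum_bound lam n) a
      & sum_distinct (small_subsets lam n) a].
Proof.
move=> _ lam3 M1; have lam0 := sum_bound_ge1_gt0 _ _ _ M1.
have [lamn|lamn] := leP 1 (lam * n%:R).
  have [a [a0 aM da]] := greedy_sequence R lam n setT lam0 lam3 lamn M1.
  exists a; split=> //; last exact: disjoint_sum_distinctT da.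
  by move=> i; rewrite aM ler0z ltW.
exists (fun=> 1); split=> // [i|A B]; first by rewrite ler01 M1.
have small0 C : C \in small_subsets lam n -> C = set0.
  rewrite inE => /le_lt_trans /(_ lamn).
  by rewrite ltrn1 ltnS leqn0 cards_eq0 => /eqP.
by move=> /small0 -> /small0 ->.
Qed.
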